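(* Let $(L,\omega)$ be a finite-dimensional quadratic Lie algebra over a field $F$ of characteristic $0$, let $r=\sum_i a_i\otimes b_i\in L\otimes L$, let $R:L\to L$ be the linear operator $R(a)=\sum_i\omega(b_i,a)a_i$, let $R^*$ be the adjoint of $R$ with respect to $\omega$, and let $\lambda\in F$ be nonzero. 1. Suppose that $r$ is a non-skew-symmetric solution of the classical Yang–Baxter equation (i.e. $r+\tau(r)\ne0$) such that $r+\tau(r)$ is $L$-invariant. Then $R$ and $R^*$ are both Rota–Baxter operators of the same nonzero weight $\lambda$ if and only if the commutator ideal $[L,L]$ is a direct sum $[L,L]=I_1\oplus I_2$ of two ideals $I_1,I_2$ of $L$ such that $R(I_1)=R^*(I_1)=0$ and $$R(x)+R^*(x)+\lambda x=0\quad\text{for all } x\in I_2 .$$ 2. Conversely, suppose that $r+\tau(r)\neq0$, that $R$ and $R^*$ are Rota–Baxter operators of the same nonzero weight $\lambda$, and that $R([a,b])+R^*([a,b])=[R(a),b]+[R^*(a),b]$ for all $a,b\in L$. Suppose that $[L,L]=I_1\oplus I_2$ is a direct sum of two ideals $I_1,I_2$ of $L$ with $R(I_1)=R^*(I_1)=0$ and $R(x)+R^*(x)+\lambda x=0$ for all $x\in I_2$. Then $r$ is a solution of the classical Yang–Baxter equation and $r+\tau(r)$ is a nonzero $L$-invariant element.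
   Context: A quadratic Lie algebra $(L,\omega)$ is a Lie algebra $L$ with a non-degenerate symmetric bilinear form $\omega$ that is invariant: $\omega([a,b],c)=\omega(a,[b,c])$ for all $a,b,c\in L$. The adjoint $R^*$ of $R$ is defined by $\omega(R(x),y)=\omega(x,R^*(y))$ for all $x,y\in L$. An element $r=\sum_i a_i\otimes b_i\in L\otimes L$ is a solution of the classical Yang–Baxter equation (CYBE) if $$\sum_{i,j}\big([a_i,a_j]\otimes b_i\otimes b_j-a_i\otimes[a_j,b_i]\otimes b_j+a_i\otimes a_j\otimes[b_i,b_j]\big)=0 .$$ $\tau$ is the switch map, $\tau(\sum_i a_i\otimes b_i)=\sum_i b_i\otimes a_i$. An element $s=\sum_i c_i\otimes d_i\in L\otimes L$ is $L$-invariant if $[s,y]:=\sum_i([c_i,y]\otimes d_i+c_i\otimes[d_i,y])=0$ for all $y\in L$. A linear map $R:L\to L$ is a Rota–Baxter operator of weight $\lambda\in F$ if $[R(x),R(y)]=R([R(x),y]+[x,R(y)]+\lambda[x,y])$ for all $x,y\in L$. $[L,L]$ denotes the linear span of all brackets. *)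

(* Defs.v *)
From HB Require Import structures.
From mathcomp Require Import all_boot all_order all_algebra.

Set Implicit Arguments.
Unset Strict Implicit.
Unset Printing Implicit Defensive.

Import GRing.Theory.
Local Open Scope ring_scope.

(** * Tensor products of finite-dimensional vector spaces

    [U ⊗ V] is realised in the coordinates of the library bases
    [vbasis {:U}] and [vbasis {:V}].  Only the universal property proved below
    ([tlift_pure], [tlift_unique]) matters: every operation on tensors is
    introduced through [tlift], i.e. by its value on pure tensors. *)

Section Tensor.
Variables (F : fieldType) (U V : vectType F).

Definition tensor : vectType F := 'M[F]_(\dim {:U}, \dim {:V}).

Definition tens (u : U) (v : V) : tensor :=
  \matrix_(i, j) (coord (vbasis {:U}) i u * coord (vbasis {:V}) j v).

(* The linear map on the tensor product induced by a bilinear map [B]. *)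
Definition tlift (W : lmodType F) (B : U -> V -> W) (t : tensor) : W :=
  \sum_i \sum_j (t : 'M[F]_(_, _)) i j *: B (vbasis {:U})`_i (vbasis {:V})`_j.

End Tensor.

Notation "x ⊗ y" := (tens x y) (at level 40, left associativity) : ring_scope.

Section TensorTheory.
Variables (F : fieldType) (U V : vectType F).

Lemma tens_bilinear : bilinear_for *:%R *:%R (@tens F U V).
Proof.
split=> [v c u u' | u c v v']; apply/matrixP=> i j; rewrite !mxE linearD linearZ.
  by rewrite mulrDl -mulrA.
by rewrite mulrDr mulrCA.
Qed.

Lemma tlift_is_linear (W : lmodType F) (B : U -> V -> W) : linear (tlift B).
Proof.
move=> c s t; rewrite /tlift scaler_sumr -big_split; apply: eq_bigr => i _ /=.
rewrite scaler_sumr -big_split; apply: eq_bigr => j _ /=.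
by rewrite !mxE scalerDl scalerA.
Qed.

HB.instance Definition _ (W : lmodType F) (B : U -> V -> W) :=
  GRing.isLinear.Build F (tensor U V) W *:%R (tlift B) (tlift_is_linear B).

Lemma tlift_pure (W : lmodType F) (B : U -> V -> W) u v :
  bilinear_for *:%R *:%R B -> tlift B (u ⊗ v) = B u v.
Proof.
case=> Bl Br.
pose f v' : {linear U -> W} :=
  HB.pack (B^~ v') (GRing.isLinear.Build F U W *:%R (B^~ v') (Bl v')).
pose g u' : {linear V -> W} :=
  HB.pack (B u') (GRing.isLinear.Build F V W *:%R (B u') (Br u')).
rewrite [in RHS](coord_vbasis (memvf u)) -[RHS]/(f v _) linear_sum.
apply: eq_bigr => i _; rewrite linearZ /= [in RHS](coord_vbasis (memvf v)).
rewrite -[B _ _]/(g _ _) linear_sum scaler_sumr; apply: eq_bigr => j _.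
by rewrite linearZ /= mxE scalerA.
Qed.

Lemma tens_decomp (t : tensor U V) :
  t = \sum_i \sum_j (t : 'M[F]_(_, _)) i j *: ((vbasis {:U})`_i ⊗ (vbasis {:V})`_j).
Proof.
have fU := basis_free (vbasisP {:U}); have fV := basis_free (vbasisP {:V}).
apply/matrixP=> i j; rewrite summxE (bigD1 i) //= [X in _ + X]big1 => [|i' ni'].
  rewrite addr0 summxE (bigD1 j) //= big1 => [|j' nj'].
    by rewrite !mxE !coord_free // !eqxx !mulr1 addr0.
  by rewrite !mxE !coord_free // (negbTE nj') !mulr0.
by rewrite summxE big1 // => j' _; rewrite !mxE !coord_free // (negbTE ni') mul0r mulr0.
Qed.

Lemma tlift_unique (W : lmodType F) (B : U -> V -> W) (h : {linear tensor U V -> W}) :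
  (forall u v, h (u ⊗ v) = B u v) -> h =1 tlift B.
Proof.
move=> hB t; rewrite [in LHS](tens_decomp t) linear_sum; apply: eq_bigr => i _.
by rewrite linear_sum; apply: eq_bigr => j _; rewrite linearZ /= hB.
Qed.

Lemma tlift_sum (W : lmodType F) (B : U -> V -> W) n (u : 'I_n -> U) (v : 'I_n -> V) :
  bilinear_for *:%R *:%R B -> tlift B (\sum_i u i ⊗ v i) = \sum_i B (u i) (v i).
Proof. by move=> hB; rewrite linear_sum; apply: eq_bigr => i _; apply: tlift_pure. Qed.

End TensorTheory.

Definition tau (F : fieldType) (U V : vectType F) : tensor U V -> tensor V U :=
  tlift (fun u v => v ⊗ u).

Lemma tau_sum (F : fieldType) (U V : vectType F) n (u : 'I_n -> U) (v : 'I_n -> V) :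
  tau (\sum_i u i ⊗ v i) = \sum_i v i ⊗ u i.
Proof.
apply: tlift_sum; have [hl hr] := tens_bilinear V U.
by split=> [y c x x' | x c y y']; [apply: hr | apply: hl].
Qed.

HB.mixin Record isLieAlgebra (F : fieldType) L of Vector F L := {
  lie : L -> L -> L;
  lie_bilinear : bilinear_for *:%R *:%R lie;
  liexx : forall x, lie x x = 0;
  lie_jacobi : forall x y z, lie x (lie y z) + lie y (lie z x) + lie z (lie x y) = 0
}.

#[short(type="lieAlgType")]
HB.structure Definition LieAlgebra (F : fieldType) :=
  { L of Vector F L & isLieAlgebra F L }.

Notation "[ 'lie' x , y ]" := (lie x y)
  (format "[ 'lie'  x ,  y ]") : ring_scope.

HB.instance Definition _ (F : fieldType) (L : lieAlgType F) :=
  bilinear_isBilinear.Build F L L L *:%R *:%R (@lie F L) (@lie_bilinear F L).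

Section LieAlgebraDefs.
Variables (F : fieldType) (L : lieAlgType F).

Definition is_ideal (I : {vspace L}) := forall x y, x \in I -> [lie x, y] \in I.

(* The span of all brackets; see [commutator_subP]. *)
Definition commutator_ideal : {vspace L} :=
  <<[seq [lie x, y] | x <- vbasis {:L}, y <- vbasis {:L}]>>%VS.

Lemma commutator_subP (W : {vspace L}) :
  reflect (forall x y, [lie x, y] \in W) (commutator_ideal <= W)%VS.
Proof.
apply: (iffP idP) => [sW x y | hW]; last first.
  by apply/span_subvP => _ /allpairsP[[x y] [_ _ ->]].
rewrite (coord_vbasis (memvf x)) linear_sumlz memv_suml // => i _.
rewrite linearZl_LR memvZ //= (coord_vbasis (memvf y)) linear_sumr memv_suml // => j _.
rewrite linearZr_LR memvZ //=; apply: (subvP sW); apply/memv_span/allpairsP.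
by exists ((vbasis {:L})`_i, (vbasis {:L})`_j); rewrite !mem_nth ?size_tuple.
Qed.

Definition invariant_form (omega : L -> L -> F) :=
  forall a b c, omega [lie a, b] c = omega a [lie b, c].

Definition is_adjoint (omega : L -> L -> F) (R Rs : 'End(L)) :=
  forall x y, omega (R x) y = omega x (Rs y).

Definition rota_baxter (lam : F) (R : 'End(L)) :=
  forall x y, [lie R x, R y] = R ([lie R x, y] + [lie x, R y] + lam *: [lie x, y]).

(* [tact y s] is [s, y]. *)
Definition tact (y : L) : tensor L L -> tensor L L :=
  tlift (fun c d => [lie c, y] ⊗ d + c ⊗ [lie d, y]).

Definition L_invariant (s : tensor L L) := forall y, tact y s = 0.

(* The outer [tlift] ranges over the summands [ai ⊗ bi] of the first copy of [r],
   the inner one over the summands [aj ⊗ bj] of the second; see [cybe_lhs_sum]. *)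
Definition cybe_lhs (r : tensor L L) : tensor (tensor L L) L :=
  tlift (fun ai bi => tlift (fun aj bj =>
    [lie ai, aj] ⊗ bi ⊗ bj - ai ⊗ [lie aj, bi] ⊗ bj + ai ⊗ aj ⊗ [lie bi, bj]) r) r.

Definition is_CYBE_solution (r : tensor L L) := cybe_lhs r = 0.

Lemma tact_sum y n (c d : 'I_n -> L) :
  tact y (\sum_i c i ⊗ d i) = \sum_i ([lie c i, y] ⊗ d i + c i ⊗ [lie d i, y]).
Proof.
have [tl tr] := tens_bilinear L L.
apply: tlift_sum; split=> [v k u u' | u k v v'] /=.
  by rewrite linearPl !tl scalerDr addrACA.
by rewrite linearPl !tr scalerDr addrACA.
Qed.

Lemma cybe_lhs_sum n (a b : 'I_n -> L) :
  cybe_lhs (\sum_i a i ⊗ b i) =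
  \sum_i \sum_j ([lie a i, a j] ⊗ b i ⊗ b j - a i ⊗ [lie a j, b i] ⊗ b j
                 + a i ⊗ a j ⊗ [lie b i, b j]).
Proof.
have [tl tr] := tens_bilinear L L.
have [Tl Tr] := tens_bilinear (tensor L L) L.
have comb (W : lmodType F) k (x x' y y' z z' : W) :
    k *: x + x' - (k *: y + y') + (k *: z + z') = k *: (x - y + z) + (x' - y' + z').
  by rewrite !scalerDr scalerN opprD [X in X + _ = _]addrACA [LHS]addrACA.
have inner ai bi : bilinear_for *:%R *:%R (fun aj bj : L =>
    [lie ai, aj] ⊗ bi ⊗ bj - ai ⊗ [lie aj, bi] ⊗ bj + ai ⊗ aj ⊗ [lie bi, bj]).
  split=> [v k u u' | u k v v'] /=.
    by rewrite linearPl linearPr !tl !tr !Tl comb.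
  by rewrite linearPr !Tr comb.
rewrite /cybe_lhs; under [LHS]eq_bigr => i _ do under eq_bigr => j _ do rewrite tlift_sum //.
rewrite -[LHS]/(tlift (fun ai bi => \sum_j ([lie ai, a j] ⊗ bi ⊗ b j
  - ai ⊗ [lie a j, bi] ⊗ b j + ai ⊗ a j ⊗ [lie bi, b j])) _).
apply: tlift_sum; split=> [v k u u' | u k v v'] /=;
  rewrite scaler_sumr -big_split; apply: eq_bigr => j _ /=.
  by rewrite linearPl !tl !Tl comb.
by rewrite linearPl linearPr !tr !Tl !Tr comb.
Qed.

End LieAlgebraDefs.

Arguments commutator_ideal {F} L.

(* Main.v *)
(** Contracting the last tensor factors against [omega] is injective, and turns
    the CYBE for [r] into [[Rx, Ry] = R([x, Ry] - [R^*x, y])] and the invariance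
    of [r + tau r] into the statement that [S = R + R^*] commutes with the adjoint
    action.  By invariance of [omega] the CYBE identity also holds with [R] and
    [R^*] exchanged.  Given both, the Rota-Baxter identities of weight [lam] say
    exactly that [R] and [R^*] vanish on [(S + lam)[L, L]].  Then
    [S (S + lam) = 0] on [[L, L]], which [S] preserves, so that [[L, L]] splits
    into the kernels of [S] and of [S + lam], and these are ideals. *)

From HB Require Import structures.
Require Import Defs.
From mathcomp Require Import all_boot all_order all_algebra.

Set Implicit Arguments.
Unset Strict Implicit.
Unset Printing Implicit Defensive.

Import GRing.Theory.
Local Open Scope ring_scope.

(** * Contraction of tensors against the form *)

Section Contraction.
Variables (F : fieldType) (L : vectType F) (omega : {symmetric L}).

Lemma form_sym x y : omega x y = omega y x.
Proof. by rewrite hermC expr0 mul1r. Qed.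

Lemma form_eq0 u : nondegenerate omega -> (forall x, omega u x = 0) -> u = 0.
Proof.
move=> /eqP ndg u0; apply/eqP; rewrite -memv0 -ndg.
by apply/mem_orthovP=> x _.
Qed.

Definition contract (U : vectType F) (x : L) : tensor U L -> U :=
  tlift (fun u v => omega v x *: u).

HB.instance Definition _ U x := GRing.Linear.on (@contract U x).

Lemma contract_pure (U : vectType F) (x : L) (u : U) v :
  contract x (u ⊗ v) = omega v x *: u.
Proof.
apply: tlift_pure; split=> [w c y y' | w c y y'] /=.
  by rewrite scalerDr !scalerA mulrC.
by rewrite linearPl scalerDl scalerA.
Qed.

(** In coordinates the contraction is [\sum_i omega (\sum_j t i j *: e_j) x *: u_i]. Freeness of the
    [u_i] kills each coefficient, non-degeneracy kills each row vector [\sum_j t i j *: e_j], and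
    freeness of the [e_j] kills the entries. *)
Lemma contract_inj (U : vectType F) (t : tensor U L) :
  nondegenerate omega -> (forall x, contract x t = 0) -> t = 0.
Proof.
move=> ndg t0.
have /freeP fU := basis_free (vbasisP {:U}).
have /freeP fL := basis_free (vbasisP {:L}).
apply/matrixP=> i j; rewrite mxE; move: j; apply: fL.
apply: form_eq0 => // x; rewrite linear_sumlz /=.
move: i; apply: fU; rewrite -[RHS](t0 x); apply: eq_bigr => i _.
by rewrite scaler_suml; apply: eq_bigr => j _; rewrite linearZl_LR scalerA.
Qed.

End Contraction.

(** * Identities for a pair of operators, and the splitting of the commutator ideal *)

Section Operators.
Variables (F : fieldType) (L : lieAlgType F).
Implicit Types R Rs : 'End(L).

Lemma lieC (x y : L) : [lie x, y] = - [lie y, x].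
Proof.
apply/eqP; rewrite -addr_eq0; apply/eqP.
by have := liexx (x + y); rewrite linearDl /= !linearDr /= !liexx add0r addr0.
Qed.

Definition cybe_op R Rs :=
  forall x y, [lie R x, R y] = R ([lie x, R y] - [lie Rs x, y]).

(** Pair the identity at [x], [y] with [z] and isolate [y]: each [lie u] is skew for [omega], and
    [R] crosses the form as [Rs]. What remains against [y] is the exchanged identity at [x], [z]. *)
Lemma cybe_op_adjoint R Rs (omega : {symmetric L}) :
  nondegenerate omega -> invariant_form omega -> is_adjoint omega R Rs ->
  cybe_op R Rs -> cybe_op Rs R.
Proof.
move=> ndg inv adj cy x z; apply/eqP; rewrite -subr_eq0; apply/eqP.
apply: form_eq0 ndg _ => y.
have move u v w : omega [lie u, v] w = - omega v [lie u, w].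
  by rewrite lieC linearNl /= inv.
have := congr1 (omega^~ z) (cy x y).
rewrite /= adj linearBl /= !move opprK => E.
have adjC u : omega y (Rs u) = omega (R y) u by rewrite adj.
by rewrite form_sym linearBr /= adjC linearBr opprB addrC -addrA -E subrr.
Qed.

(** For [z = u + v] with [u] in [I1] and [v] in [I2], the argument of the outer [R] reduces to
    [lam *: u], which [R] kills. *)
Lemma vanish_of_splitting R Rs lam (I1 I2 : {vspace L}) :
  commutator_ideal L = (I1 + I2)%VS -> (R @: I1 = 0)%VS -> (Rs @: I1 = 0)%VS ->
  (forall x, x \in I2 -> R x + Rs x + lam *: x = 0) ->
  forall z, z \in commutator_ideal L -> R (R z + Rs z + lam *: z) = 0.
Proof.
move=> -> /eqP; rewrite -lkerE => /subvP R1 /eqP; rewrite -lkerE => /subvP Rs1 S2 z.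
case/memv_addP=> u uI1 [v vI2 ->].
move: (R1 u uI1) (Rs1 u uI1); rewrite !memv_ker => /eqP Ru /eqP Rsu.
rewrite [R (u + v)]linearD [Rs (u + v)]linearD /= Ru Rsu !add0r scalerDr addrCA S2 // addr0.
by rewrite linearZ /= Ru scaler0.
Qed.

Section Commuting.
Variables R Rs : 'End(L).
Hypothesis commS : forall x y,
  R [lie x, y] + Rs [lie x, y] = [lie R x, y] + [lie Rs x, y].

(** [commS] replaces [[lie R x, y]] by [R z + Rs z - [lie Rs x, y]], which isolates the CYBE
    term. *)
Lemma rota_baxter_defect lam x y (z := [lie x, y]) :
  R ([lie R x, y] + [lie x, R y] + lam *: z) =
  R ([lie x, R y] - [lie Rs x, y]) + R (R z + Rs z + lam *: z).
Proof.
rewrite -linearD /=; apply: (congr1 R); rewrite commS.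
by rewrite [[lie R x, y] + _ in RHS]addrC -!addrA addKr addrCA.
Qed.

Lemma rota_baxter_iff lam : cybe_op R Rs ->
  rota_baxter lam R <->
  (forall z, z \in commutator_ideal L -> R (R z + Rs z + lam *: z) = 0).
Proof.
move=> cy; split=> [rb|h x y]; last first.
  rewrite rota_baxter_defect h ?addr0 ?cy //.
  by have /commutator_subP := subvv (commutator_ideal L); apply.
(* As the kernel of a linear map is a subspace, it suffices to test brackets. *)
pose f := (R \o (R + Rs + lam *: \1))%VF.
have fE z : f z = R (R z + Rs z + lam *: z).
  by rewrite comp_lfunE !add_lfunE scale_lfunE id_lfunE.
have : (commutator_ideal L <= lker f)%VS.
  apply/commutator_subP=> x y; rewrite memv_ker fE; apply/eqP.
  by apply: (addrI [lie R x, R y]); rewrite addr0 {2}rb rota_baxter_defect cy.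
by move=> /subvP sub z /sub; rewrite memv_ker fE => /eqP.
Qed.

Lemma splitting_iff lam : lam != 0 ->
  (forall z, z \in commutator_ideal L -> R (R z + Rs z + lam *: z) = 0) /\
  (forall z, z \in commutator_ideal L -> Rs (Rs z + R z + lam *: z) = 0) <->
  exists I1 I2 : {vspace L},
    is_ideal I1 /\ is_ideal I2 /\
    commutator_ideal L = (I1 + I2)%VS /\ directv (I1 + I2) /\
    (R @: I1 = 0)%VS /\ (Rs @: I1 = 0)%VS /\
    (forall x, x \in I2 -> R x + Rs x + lam *: x = 0).
Proof.
move=> lam0; split=> [[hR hRs] | [I1 [I2 [_ [_ [dec [_ [R1 [Rs1 S2]]]]]]]]]; last first.
  split; first exact: vanish_of_splitting dec R1 Rs1 S2.
  by apply: vanish_of_splitting dec Rs1 R1 _ => x /S2; rewrite [Rs x + _]addrC.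
have /commutator_subP lieL := subvv (commutator_ideal L).
pose S := R + Rs; pose T := S + lam *: \1%VF.
have SE x : S x = R x + Rs x by rewrite add_lfunE.
have TE x : T x = R x + Rs x + lam *: x.
  by rewrite add_lfunE scale_lfunE id_lfunE SE.
(* Commuting with brackets makes the kernels of [S] and [T] stable under bracketing, hence the two
   intersections below ideals. *)
have SL x y : S [lie x, y] = [lie S x, y] by rewrite !SE commS linearDl.
have TL x y : T [lie x, y] = [lie T x, y] by rewrite !TE commS !linearDl linearZl_LR.
have scaleE z : S z = 0 -> lam *: z = T z by rewrite SE TE => ->; rewrite add0r.
have STz z : z \in commutator_ideal L -> S (T z) = 0.
  by move=> zL; rewrite SE TE hR // [R z + _]addrC hRs // addr0.
have SLin z : z \in commutator_ideal L -> S z \in commutator_ideal L.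
  move: z; have /subvP sub : (commutator_ideal L <= S @^-1: commutator_ideal L)%VS.
    by apply/commutator_subP => x y; rewrite -memv_preim SL.
  by move=> z /sub; rewrite -memv_preim.
exists (commutator_ideal L :&: lker S)%VS, (commutator_ideal L :&: lker T)%VS.
(* On the kernel of [S], [T] is multiplication by [lam], so [f (T z) = 0] forces [f z = 0]. *)
have ker0 (f : 'End(L)) :
    (forall z, z \in commutator_ideal L -> f (T z) = 0) ->
    (f @: (commutator_ideal L :&: lker S) = 0)%VS.
  move=> h; apply/eqP; rewrite -lkerE; apply/subvP=> z.
  rewrite memv_cap !memv_ker => /andP[zL /eqP Sz].
  by have /eqP := h _ zL; rewrite -scaleE // linearZ scaler_eq0 (negPf lam0).
split; [|split; [|split; [|split; [|split; [|split]]]]].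
- move=> x y; rewrite !memv_cap !memv_ker SL => /andP[_ /eqP->].
  by rewrite linear0l lieL eqxx.
- move=> x y; rewrite !memv_cap !memv_ker TL => /andP[_ /eqP->].
  by rewrite linear0l lieL eqxx.
- apply/eqP; rewrite eqEsubv subv_add !capvSl !andbT; apply/subvP => z zL.
  have TS : T z = S z + lam *: z by rewrite TE SE.
  have TSz : T (S z) = 0.
    by rewrite -(STz z zL) TS TE -SE linearD linearZ.
  (* Since [T - S] is the scalar [lam] and [S T = T S = 0] on the commutator ideal, these two terms
     lie in the kernels of [S] and [T] respectively. *)
  have -> : z = lam^-1 *: T z - lam^-1 *: S z.
    by rewrite TS -scalerBr addrC addKr scalerA mulVf // scale1r.
  rewrite memv_add ?memvN ?memvZ // memv_cap memv_ker ?STz ?TSz ?eqxx ?SLin // andbT.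
  by rewrite TS memvD ?SLin ?memvZ.
- apply/directv_addP/eqP; rewrite -subv0; apply/subvP=> z.
  rewrite !memv_cap !memv_ker => /andP[/andP[_ /eqP Sz] /andP[_ /eqP Tz]].
  by move: (scaleE z Sz); rewrite Tz memv0 => /eqP; rewrite scaler_eq0 (negPf lam0).
- by apply: ker0 => z zL; rewrite TE hR.
- by apply: ker0 => z zL; rewrite TE [R z + _]addrC hRs.
by move=> x; rewrite memv_cap memv_ker TE => /andP[_ /eqP].
Qed.

End Commuting.

End Operators.

(** * Translation of tensor conditions into operator identities *)

Section TensorToOperator.
Variables (F : fieldType) (L : lieAlgType F) (omega : {symmetric L}).
Hypotheses (ndg : nondegenerate omega) (inv : invariant_form omega).
Variables (n : nat) (a b : 'I_n -> L) (r : tensor L L) (R Rs : 'End(L)).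
Hypothesis rE : r = \sum_i a i ⊗ b i.
Hypothesis RE : forall x, R x = \sum_i omega (b i) x *: a i.
Hypothesis adj : is_adjoint omega R Rs.

(** Exchanging [a] and [b] shows that [Rs] is the operator attached to [tau r], so [r + tau r]
    corresponds to [R + Rs]. *)
Lemma adjointE x : Rs x = \sum_i omega (a i) x *: b i.
Proof.
apply/eqP; rewrite -subr_eq0; apply/eqP; apply: (form_eq0 ndg) => y.
rewrite linearBl /= form_sym -adj RE !linear_sumlz -sumrB.
by apply: big1 => i _; rewrite !linearZl_LR /= mulrC subrr.
Qed.

Lemma contract_cybe_lhs x y :
  contract omega x (contract omega y (cybe_lhs r)) =
  [lie R x, R y] - R ([lie x, R y] - [lie Rs x, y]).
Proof.
pose g : {linear tensor (tensor L L) L -> L} := contract omega x \o contract omega y.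
have gE u v w : g (u ⊗ v ⊗ w) = omega w y *: (omega v x *: u).
  by rewrite /= contract_pure linearZ /= contract_pure.
rewrite -[LHS]/(g _) rE cybe_lhs_sum.
transitivity (\sum_i \sum_j (omega (b j) y *: (omega (b i) x *: [lie a i, a j])
    - omega (b j) y *: (omega [lie a j, b i] x *: a i)
    + omega [lie b i, b j] y *: (omega (a j) x *: a i))).
  rewrite linear_sum; apply: eq_bigr => i _; rewrite linear_sum; apply: eq_bigr => j _.
  by rewrite linearD linearB !gE.
have bracket : [lie R x, R y] =
    \sum_i \sum_j omega (b j) y *: (omega (b i) x *: [lie a i, a j]).
  rewrite !RE linear_sumlz; apply: eq_bigr => i _; rewrite linear_sumr.
  by apply: eq_bigr => j _; rewrite linearZr_LR linearZl_LR.
(* Invariance and symmetry turn [omega [lie a j, b i] x] into [omega (b i) [lie x, a j]]; the next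
   identity moves [b j] off [b i] likewise. *)
have right : R [lie x, R y] =
    \sum_i \sum_j omega (b j) y *: (omega [lie a j, b i] x *: a i).
  rewrite RE; apply: eq_bigr => i _.
  rewrite RE linear_sumr linear_sumr scaler_suml; apply: eq_bigr => j _.
  by rewrite !linearZr_LR /= scalerA (form_sym omega (b i)) inv (form_sym omega x).
have left : R [lie Rs x, y] =
    \sum_i \sum_j omega [lie b i, b j] y *: (omega (a j) x *: a i).
  rewrite RE; apply: eq_bigr => i _.
  rewrite adjointE linear_sumlz linear_sumr scaler_suml; apply: eq_bigr => j _.
  by rewrite linearZl_LR linearZr_LR /= scalerA inv mulrC.
rewrite linearB /= bracket right left opprB addrA addrAC -sumrB -big_split.
by apply: eq_bigr => i _; rewrite -sumrB -big_split.
Qed.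

(** Kept general in [c] and [d] to serve both [r] and [tau r]. The minus sign comes from [omega
    [lie d i, y] x = - omega (d i) [lie x, y]]. *)
Lemma contract_tact_sum x y m (c d : 'I_m -> L) :
  contract omega x (tact y (\sum_i c i ⊗ d i)) =
  [lie \sum_i omega (d i) x *: c i, y] - \sum_i omega (d i) [lie x, y] *: c i.
Proof.
rewrite tact_sum (linear_sum (contract omega x)) linear_sumlz -sumrB.
apply: eq_bigr => i _.
rewrite (linearD (contract omega x)) /= !contract_pure linearZl_LR /= inv.
by rewrite [[lie y, x]]lieC linearNr scaleNr.
Qed.

Lemma contract_tact x y :
  contract omega x (tact y (r + tau r)) =
  [lie R x, y] + [lie Rs x, y] - (R [lie x, y] + Rs [lie x, y]).
Proof.
have tactD s t : tact y (s + t) = tact y s + tact y t by rewrite /tact linearD.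
rewrite rE tau_sum tactD (linearD (contract omega x)) /= !contract_tact_sum.
by rewrite -!RE -!adjointE addrACA opprD.
Qed.

Lemma cybe_solutionP : is_CYBE_solution r <-> cybe_op R Rs.
Proof.
split=> [cy x y | cy].
  apply/eqP; rewrite -subr_eq0 -contract_cybe_lhs.
  by move: cy; rewrite /is_CYBE_solution => ->; rewrite !linear0.
apply: (contract_inj ndg) => y; apply: (contract_inj ndg) => x.
by rewrite contract_cybe_lhs cy subrr.
Qed.

Lemma L_invariantP : L_invariant (r + tau r) <->
  forall x y, R [lie x, y] + Rs [lie x, y] = [lie R x, y] + [lie Rs x, y].
Proof.
split=> [h x y | h y].
  by apply/esym/eqP; rewrite -subr_eq0 -contract_tact h linear0.
by apply: (contract_inj ndg) => x; rewrite contract_tact h subrr.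
Qed.

End TensorToOperator.

Theorem theorem3 (F : fieldType) (L : lieAlgType F) (omega : {symmetric L})
    (n : nat) (a b : 'I_n -> L) (r : tensor L L) (R Rs : 'End(L)) (lam : F) :
  [pchar F] =i pred0 ->
  nondegenerate omega ->
  invariant_form omega ->
  r = \sum_(i < n) a i ⊗ b i ->
  (forall x : L, R x = \sum_(i < n) omega (b i) x *: a i) ->
  is_adjoint omega R Rs ->
  lam != 0 ->
  (is_CYBE_solution r -> r + tau r != 0 -> L_invariant (r + tau r) ->
     (rota_baxter lam R /\ rota_baxter lam Rs <->
      exists I1 I2 : {vspace L},
        is_ideal I1 /\ is_ideal I2 /\
        commutator_ideal L = (I1 + I2)%VS /\ directv (I1 + I2) /\
        (R @: I1 = 0)%VS /\ (Rs @: I1 = 0)%VS /\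
        (forall x, x \in I2 -> R x + Rs x + lam *: x = 0)))
  /\
  (r + tau r != 0 -> rota_baxter lam R -> rota_baxter lam Rs ->
   (forall x y : L, R [lie x, y] + Rs [lie x, y] = [lie R x, y] + [lie Rs x, y]) ->
   forall I1 I2 : {vspace L},
     is_ideal I1 -> is_ideal I2 ->
     commutator_ideal L = (I1 + I2)%VS -> directv (I1 + I2) ->
     (R @: I1 = 0)%VS -> (Rs @: I1 = 0)%VS ->
     (forall x, x \in I2 -> R x + Rs x + lam *: x = 0) ->
     is_CYBE_solution r /\ r + tau r != 0 /\ L_invariant (r + tau r)).
Proof.
move=> _ ndg inv rE RE adj lam0.
have cyP := cybe_solutionP ndg inv rE RE adj.
have invP := L_invariantP ndg inv rE RE adj.
split=> [/cyP cy _ /invP commS | r0 rb rbs commS I1 I2 _ _ dec _ R1 Rs1 S2].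
  (* Exchanging [R] and [Rs] lets [rota_baxter_iff] apply to [Rs] as well. *)
  have cys := cybe_op_adjoint ndg inv adj cy.
  have commS' x y : Rs [lie x, y] + R [lie x, y] = [lie Rs x, y] + [lie R x, y].
    by rewrite addrC commS addrC.
  apply: iff_trans (splitting_iff commS lam0).
  by split=> -[h hs]; split;
    [apply/(rota_baxter_iff commS) | apply/(rota_baxter_iff commS')
    | apply/(rota_baxter_iff commS) | apply/(rota_baxter_iff commS')].
split; last by split=> //; apply/invP.
(* The splitting makes the defect vanish, so the Rota-Baxter identity for [R] becomes the operator
   form of the CYBE. *)
apply/cyP => x y; rewrite rb (rota_baxter_defect commS).
rewrite (vanish_of_splitting dec R1 Rs1 S2) ?addr0 //.
by have /commutator_subP := subvv (commutator_ideal L).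
Qed.
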